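(* Let $X$ be a real normed vector space, $L\subset S_X$ a nonempty closed set, $K\subset X$ a proper closed convex cone, and $M\subset X$ a nonempty set. Suppose that $\operatorname{cone}L\cap(-K)\neq\{0\}$. If for $\overline{x}\in M$ one has $$T_B^L(\operatorname{cl}(M+K),\overline{x})\cap(-K)\subset K,$$ then $\overline{x}$ is a directional Pareto minimum for $M$ with respect to $L$.
   Context: $S_X$ is the unit sphere of $X$; $\operatorname{cone}C=\{tc\mid t\ge0,\ c\in C\}$; $\operatorname{cl}$ is topological closure. A convex cone $K\subset X$ is proper if $K\neq\{0\}$ and $K\neq X$ (not necessarily pointed). Directional Pareto minimum of a set: $\overline{x}\in M$ is a directional Pareto minimum for $M$ with respect to $L$ if $(M\cap(\overline{x}+\operatorname{cone}L)-\overline{x})\cap(-K)\subset K$. Directional Bouligand tangent cone: for nonempty $A\subset X$ and $\overline{x}\in A$, $T_B^L(A,\overline{x})$ is the set of all $u\in X$ for which there are $(u_n)\subset\operatorname{cone}L$ with $u_n\to u$ and $(t_n)\subset(0,\infty)$ with $t_n\to0$ such that $\overline{x}+t_nu_n\in A$ for all $n$. *)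

(* Defs.v *)
From HB Require Import structures.
From mathcomp Require Import all_boot all_order all_algebra.
From mathcomp Require Import all_classical all_reals all_analysis.

Set Implicit Arguments.
Unset Strict Implicit.
Unset Printing Implicit Defensive.

Import Order.TTheory GRing.Theory Num.Theory.
Import numFieldNormedType.Exports.

Local Open Scope classical_set_scope.
Local Open Scope ring_scope.

Section directional.
Context {R : realType} {X : normedModType R}.
Implicit Types (A C K L M : set X) (x : X).

Definition unit_sphere : set X := [set x | `|x| = 1].

Definition cone C : set X := [set t *: c | t in [set t : R | 0 <= t] & c in C].

Definition setopp A : set X := [set - a | a in A].

Definition setadd A B : set X := [set a + b | a in A & b in B].

Definition translate x A : set X := [set x + a | a in A].

(* Nonemptiness is part of the notion, so that a cone contains 0. *)
Definition is_cone K : Prop :=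
  K !=set0 /\ forall (t : R) (k : X), 0 <= t -> K k -> K (t *: k).

Definition proper_cone K : Prop := K <> [set 0] /\ K <> setT.

(* The underlying set is given for every [x]; the notion is only meant for
   [x] in [A], which is assumed where it matters. *)
Definition dir_bouligand_cone L A x : set X :=
  [set u | exists (u_ : nat -> X) (t_ : nat -> R),
    [/\ forall n, cone L (u_ n),
        u_ n @[n --> \oo] --> u,
        forall n, 0 < t_ n,
        t_ n @[n --> \oo] --> (0 : R) &
        forall n, A (x + t_ n *: u_ n)]].

Definition dir_pareto_min K L M x : Prop :=
  M x /\
  translate (- x) (M `&` translate x (cone L)) `&` setopp K `<=` K.

End directional.
Arguments unit_sphere {R} X.

(* Main.v *)
Require Import Defs.
From HB Require Import structures.
From mathcomp Require Import all_boot all_order all_algebra.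
From mathcomp Require Import all_classical all_reals all_analysis.

Set Implicit Arguments.
Unset Strict Implicit.
Unset Printing Implicit Defensive.

Import Order.TTheory GRing.Theory Num.Theory.
Import numFieldNormedType.Exports.

Local Open Scope classical_set_scope.
Local Open Scope ring_scope.

(** Let [u] in [cone L] and in -K lead from [xbar] to a point [m] of [M]. Going back from [m]
    towards [xbar] adds nonnegative multiples of -u, which lie in [K], so the whole segment lies in
    M + K. Hence [u] is a directional tangent to M + K at [xbar], and [tangent] puts it in [K]. *)

Theorem theorem4p4 (R : realType) (X : normedModType R) (L K M : set X)
  (L_sphere : L `<=` unit_sphere X) (L_nonempty : L !=set0)
  (L_closed : closed L)
  (K_cone : is_cone K) (K_convex : convex_set K) (K_closed : closed K)
  (K_proper : proper_cone K)
  (M_nonempty : M !=set0)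
  (LK : cone L `&` setopp K <> [set 0])
  (xbar : X) (Mxbar : M xbar)
  (tangent : dir_bouligand_cone L (closure (setadd M K)) xbar `&` setopp K
             `<=` K) :
  dir_pareto_min K L M xbar.
Proof.
split=> // u [[m [Mm [c Lc mE]] uE] [k Kk ku]].
have mxu : m = xbar + u by rewrite -uE addNKr.
have cu : c = u by apply: (addrI xbar); rewrite mE.
apply: tangent; split; last by exists k.
(* Since [u] itself lies in [cone L], constant directions suffice. The steps 1/(n+1) are positive,
   tend to 0 and never exceed 1, so they stay on the segment. *)
exists (fun=> u), harmonic; split.
- by move=> _; rewrite -cu.
- exact: cvg_cst.
- exact: harmonic_gt0.
- exact: cvg_harmonic.
- (* [xbar + t u = m + (1 - t) (- u)], with [- u] in [K] and [t <= 1]. *)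
  move=> n; apply: subset_closure; exists m => //.
  exists ((1 - harmonic n) *: k).
    apply: K_cone.2 => //.
    by rewrite subr_ge0 /harmonic /= invf_le1 ?ltr0n// ler1n.
  by rewrite mxu -ku scalerBl scale1r scalerN -addrA addKr.
Qed.
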